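(* The logic $\mathcal L(\bar 2^e)$ corresponding to the variety $\mathbb V(\mathbf{\bar 2^e})$ is defined, as an axiomatic extension of the logic $\mathcal L(2^e,\bar 2^e)$, by the axiom $(\bot\to\top)\to_H\bot$.
   Context: Language: $\langle\vee,\wedge,\to,\sim,\bot,\top\rangle$ of arities $2,2,2,1,0,0$. $\alpha\to_H\beta$ abbreviates $\alpha\to(\alpha\wedge\beta)$. The logic $\mathcal{DHMSH}$ is the Hilbert-style logic with axiom schemes: (A1) $\alpha\to_H(\alpha\vee\beta)$; (A2) $\beta\to_H(\alpha\vee\beta)$; (A3) $(\alpha\to_H\gamma)\to_H[(\beta\to_H\gamma)\to_H((\alpha\vee\beta)\to_H\gamma)]$; (A4) $(\alpha\wedge\beta)\to_H\alpha$; (A5) $(\gamma\to_H\alpha)\to_H[(\gamma\to_H\beta)\to_H(\gamma\to_H(\alpha\wedge\beta))]$; (A6) $\top$; (A7) $\bot\to_H\alpha$; (A8) $((\alpha\wedge\beta)\to_H\gamma)\to_H(\alpha\to_H(\beta\to_H\gamma))$; (A9) $(\alpha\to_H(\beta\to_H\gamma))\to_H((\alpha\wedge\beta)\to_H\gamma)$; (A10) $(\alpha\to_H\beta)\to_H((\beta\to_H\alpha)\to_H((\alpha\to\gamma)\to_H(\beta\to\gamma)))$; (A11) $(\alpha\to_H\beta)\to_H((\beta\to_H\alpha)\to_H((\gamma\to\beta)\to_H(\gamma\to\alpha)))$; (A12) $\top\to_H{\sim}\bot$; (A13) ${\sim}\top\to_H\bot$; (A14) ${\sim}(\alpha\wedge\beta)\to_H({\sim}\alpha\vee{\sim}\beta)$;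 and rules (SMP): from $\phi$ and $\phi\to_H\gamma$ deduce $\gamma$; (SCP): from $\phi\to_H\gamma$ deduce ${\sim}\gamma\to_H{\sim}\phi$ (both applicable to any formulas derived from the premises). An axiomatic extension is obtained by adjoining new axiom schemes and keeping the same rules. A semi-Heyting algebra is an algebra $\langle L,\vee,\wedge,\to,0,1\rangle$ such that $\langle L,\vee,\wedge,0,1\rangle$ is a lattice with $0$ and $1$, and $x\wedge(x\to y)\approx x\wedge y$, $x\wedge(y\to z)\approx x\wedge[(x\wedge y)\to(x\wedge z)]$, $x\to x\approx1$. $\mathbb{DHMSH}$ is the variety of algebras $\langle A,\vee,\wedge,\to,{}',0,1\rangle$ such that $\langle A,\vee,\wedge,\to,0,1\rangle$ is a semi-Heyting algebra and $0'\approx1$, $1'\approx0$, $(x\wedge y)'\approx x'\vee y'$. Formulas are interpreted with $\sim,\bot,\top$ as ${}',0,1$. The logic corresponding to a subvariety $\mathbb V$ of $\mathbb{DHMSH}$ is the unique axiomatic extension $\mathcal E$ of $\mathcal{DHMSH}$ such that $\mathbb V=\{\mathbf A\in\mathbb{DHMSH}:\mathbf A\models\delta\approx1\text{ for every theorem }\delta\text{ of }\mathcal E\}$; $\mathbb V$ is then the equivalent algebraic semantics of $\mathcal E$. $\mathbf{2^e}$ and $\mathbf{\bar 2^e}$ are the algebras on the two-element lattice $0<1$ with $0'=1$, $1'=0$; in $\mathbf{2^e}$: $0\to0=0\to1=1\to1=1$, $1\to0=0$; in $\mathbf{\bar 2^e}$: $0\to0=1\to1=1$, $0\to1=1\to0=0$.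 $\mathbb V(\cdot)$ denotes the generated variety. $\mathcal L(2^e,\bar 2^e)$ is the logic corresponding to $\mathbb V(\mathbf{2^e},\mathbf{\bar 2^e})$. *)

(* Defs.v *)
Inductive formula : Type :=
  | Var (n : nat)
  | Or (a b : formula)
  | And (a b : formula)
  | Imp (a b : formula)
  | Neg (a : formula)
  | Bot
  | Top.

Definition ImpH (a b : formula) : formula := Imp a (And a b).

Declare Scope fml_scope.
Delimit Scope fml_scope with fml.
Bind Scope fml_scope with formula.
Notation "a \/ b" := (Or a b) : fml_scope.
Notation "a /\ b" := (And a b) : fml_scope.
Notation "~ a" := (Neg a) : fml_scope.
Notation "a --> b" := (Imp a b) (at level 90, right associativity) : fml_scope.
Notation "a -->H b" := (ImpH a b) (at level 90, right associativity) : fml_scope.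

Fixpoint subst (s : nat -> formula) (f : formula) : formula :=
  match f with
  | Var n => s n
  | Or a b => Or (subst s a) (subst s b)
  | And a b => And (subst s a) (subst s b)
  | Imp a b => Imp (subst s a) (subst s b)
  | Neg a => Neg (subst s a)
  | Bot => Bot
  | Top => Top
  end.

Inductive DHMSH_axiom : formula -> Prop :=
  | A1 a b : DHMSH_axiom (a -->H (a \/ b))
  | A2 a b : DHMSH_axiom (b -->H (a \/ b))
  | A3 a b c : DHMSH_axiom ((a -->H c) -->H ((b -->H c) -->H ((a \/ b) -->H c)))
  | A4 a b : DHMSH_axiom ((a /\ b) -->H a)
  | A5 a b c : DHMSH_axiom ((c -->H a) -->H ((c -->H b) -->H (c -->H (a /\ b))))
  | A6 : DHMSH_axiom Top
  | A7 a : DHMSH_axiom (Bot -->H a)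
  | A8 a b c : DHMSH_axiom (((a /\ b) -->H c) -->H (a -->H (b -->H c)))
  | A9 a b c : DHMSH_axiom ((a -->H (b -->H c)) -->H ((a /\ b) -->H c))
  | A10 a b c :
      DHMSH_axiom ((a -->H b) -->H ((b -->H a) -->H ((a --> c) -->H (b --> c))))
  | A11 a b c :
      DHMSH_axiom ((a -->H b) -->H ((b -->H a) -->H ((c --> b) -->H (c --> a))))
  | A12 : DHMSH_axiom (Top -->H (~ Bot))
  | A13 : DHMSH_axiom ((~ Top) -->H Bot)
  | A14 a b : DHMSH_axiom ((~ (a /\ b)) -->H ((~ a) \/ (~ b))).

(** A set [S] of formulas presents the axiomatic extension of DHMSH whose new
    axiom schemes are the members of [S], with propositional variables playing
    the role of metavariables: every substitution instance is an axiom.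
    [derives S G f] is the consequence relation of that extension; both rules
    apply to anything derived from the premises [G]. *)
Inductive derives (S : formula -> Prop) (G : formula -> Prop) : formula -> Prop :=
  | d_prem f : G f -> derives S G f
  | d_base f : DHMSH_axiom f -> derives S G f
  | d_new f s : S f -> derives S G (subst s f)
  | d_SMP f g : derives S G f -> derives S G (f -->H g) -> derives S G g
  | d_SCP f g : derives S G (f -->H g) -> derives S G ((~ g) -->H (~ f)).

Definition is_theorem (S : formula -> Prop) (f : formula) : Prop :=
  derives S (fun _ => False) f.

Definition same_logic (S S' : formula -> Prop) : Prop :=
  forall G f, derives S G f <-> derives S' G f.

Definition adjoin (S : formula -> Prop) (ax : formula) : formula -> Prop :=
  fun f => S f \/ f = ax.

Record algebra : Type := Algebra {
  carrier :> Type;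
  join : carrier -> carrier -> carrier;
  meet : carrier -> carrier -> carrier;
  arrow : carrier -> carrier -> carrier;
  prime : carrier -> carrier;
  zero : carrier;
  one : carrier
}.

Arguments join {_} _ _.
Arguments meet {_} _ _.
Arguments arrow {_} _ _.
Arguments prime {_} _.
Arguments zero {_}.
Arguments one {_}.

Record is_bounded_lattice (A : algebra) : Prop := {
  joinC : forall x y : A, join x y = join y x;
  meetC : forall x y : A, meet x y = meet y x;
  joinA : forall x y z : A, join x (join y z) = join (join x y) z;
  meetA : forall x y z : A, meet x (meet y z) = meet (meet x y) z;
  join_meet : forall x y : A, join x (meet x y) = x;
  meet_join : forall x y : A, meet x (join x y) = x;
  join_zero : forall x : A, join x zero = x;
  meet_one : forall x : A, meet x one = x
}.

Record is_semi_Heyting (A : algebra) : Prop := {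
  sH_lattice : is_bounded_lattice A;
  sH_meet_arrow : forall x y : A, meet x (arrow x y) = meet x y;
  sH_meet_arrow_meet : forall x y z : A,
    meet x (arrow y z) = meet x (arrow (meet x y) (meet x z));
  sH_arrow_diag : forall x : A, arrow x x = one
}.

Record is_DHMSH (A : algebra) : Prop := {
  DH_semi_Heyting : is_semi_Heyting A;
  DH_prime_zero : prime (zero : A) = one;
  DH_prime_one : prime (one : A) = zero;
  DH_prime_meet : forall x y : A, prime (meet x y) = join (prime x) (prime y)
}.

Fixpoint eval (A : algebra) (v : nat -> A) (f : formula) : A :=
  match f with
  | Var n => v n
  | Or a b => join (eval A v a) (eval A v b)
  | And a b => meet (eval A v a) (eval A v b)
  | Imp a b => arrow (eval A v a) (eval A v b)
  | Neg a => prime (eval A v a)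
  | Bot => zero
  | Top => one
  end.

Definition validates (A : algebra) (f : formula) : Prop :=
  forall v : nat -> A, eval A v f = one.

Record is_hom (A B : algebra) (h : A -> B) : Prop := {
  hom_join : forall x y, h (join x y) = join (h x) (h y);
  hom_meet : forall x y, h (meet x y) = meet (h x) (h y);
  hom_arrow : forall x y, h (arrow x y) = arrow (h x) (h y);
  hom_prime : forall x, h (prime x) = prime (h x);
  hom_zero : h zero = zero;
  hom_one : h one = one
}.

Definition product (I : Type) (F : I -> algebra) : algebra := {|
  carrier := forall i, F i;
  join x y := fun i => join (x i) (y i);
  meet x y := fun i => meet (x i) (y i);
  arrow x y := fun i => arrow (x i) (y i);
  prime x := fun i => prime (x i);
  zero := fun i => zero;
  one := fun i => one
|}.

(** Subalgebras are taken up to isomorphism, as domains of injective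
    homomorphisms. *)
Record is_variety (C : algebra -> Prop) : Prop := {
  variety_H : forall (A B : algebra) (h : A -> B),
    is_hom A B h -> (forall y, exists x, h x = y) -> C A -> C B;
  variety_S : forall (A B : algebra) (h : A -> B),
    is_hom A B h -> (forall x y, h x = h y -> x = y) -> C B -> C A;
  variety_P : forall (I : Type) (F : I -> algebra),
    (forall i, C (F i)) -> C (product I F)
}.

Definition generated_variety (K : algebra -> Prop) : algebra -> Prop :=
  fun A => forall C : algebra -> Prop,
    is_variety C -> (forall B, K B -> C B) -> C A.

Definition corresponds (V : algebra -> Prop) (S : formula -> Prop) : Prop :=
  forall A, V A <-> (is_DHMSH A /\ forall d, is_theorem S d -> validates A d).

Definition is_logic_of (V : algebra -> Prop) (S : formula -> Prop) : Prop :=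
  corresponds V S /\ forall S', corresponds V S' -> same_logic S' S.

Definition two_e : algebra := {|
  carrier := bool;
  join := orb;
  meet := andb;
  arrow x y := match x, y with
               | false, false => true
               | false, true => true
               | true, false => false
               | true, true => true
               end;
  prime := negb;
  zero := false;
  one := true
|}.

Definition two_bar_e : algebra := {|
  carrier := bool;
  join := orb;
  meet := andb;
  arrow x y := match x, y with
               | false, false => true
               | false, true => false
               | true, false => false
               | true, true => true
               end;
  prime := negb;
  zero := false;
  one := true
|}.

Definition V_two_e_two_bar_e : algebra -> Prop :=
  generated_variety (fun A => A = two_e \/ A = two_bar_e).

Definition V_two_bar_e : algebra -> Prop :=
  generated_variety (fun A => A = two_bar_e).

(* Main.v *)
Require Import Defs.
From Stdlib Require Import Arith ClassicalEpsilon.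
From Stdlib Require Import FunctionalExtensionality PropExtensionality ProofIrrelevance.

(** The statement follows from two standard completeness facts and one formula.

    Uniqueness of the logic of a class [V]: the formulas modulo provable
    equivalence in an extension [S] form an algebra of DHMSH that validates
    exactly the theorems of [S] ([lindenbaum_DHMSH], [lindenbaum_validates]).
    If [S] and [S'] both correspond to [V], the algebra of [S] lies in [V], so it
    validates the theorems of [S'], which are therefore theorems of [S]; by
    symmetry the two logics coincide ([corresponds_unique]).  That [-->H] is a
    residuated implication is not immediate, since the calculus has neither
    [a -->H a] nor transitivity as axioms; both come from replacing equivalents
    inside [-->] by [A10] and [A11].

    Membership in a generated variety: by Birkhoff's theorem, an algebra that
    satisfies all the equations of some generators belongs to every variety
    containing them ([variety_of_equations]).  In DHMSH an equation [f = g]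
    amounts to the validity of [f -->H g] and [g -->H f], so formulas suffice
    ([variety_of_formulas]).  Hence the formulas valid in both two-element
    algebras present a logic of the variety they generate.

    For the axiom [(Bot --> Top) -->H Bot]: in a DHMSH algebra it says that
    0 -> 1 is 0.  The value of 0 -> 1 is 1 in [two_e] and 0 in [two_bar_e], so if
    [d] is valid in [two_bar_e], then [(Bot --> Top) \/ d] is valid in both.  A
    member of the larger variety in which 0 -> 1 = 0 thus validates [d], and so
    lies in the variety generated by [two_bar_e]. *)

(** * The order of provable implication *)

(** [entails S a b]: the implication from [a] to [b] is a theorem of [S]. *)
Definition entails (S : formula -> Prop) (a b : formula) : Prop :=
  is_theorem S (a -->H b).

Definition equivalent (S : formula -> Prop) (a b : formula) : Prop :=
  entails S a b /\ entails S b a.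

Lemma theorem_ax S f : DHMSH_axiom f -> is_theorem S f.
Proof. apply d_base. Qed.

Lemma theorem_mp S f g : entails S f g -> is_theorem S f -> is_theorem S g.
Proof. intros H1 H2; exact (d_SMP _ _ _ _ H2 H1). Qed.

Lemma entails_theorem S a b : is_theorem S b -> entails S a b.
Proof.
intros H; refine (theorem_mp _ _ _ _ H).
refine (theorem_mp _ _ _ _ (theorem_ax _ _ (A4 b a))).
apply theorem_ax, A8.
Qed.

Lemma entails_andl S a b : entails S (a /\ b) a.
Proof. apply theorem_ax, A4. Qed.

Lemma entails_and S a b c :
  entails S c a -> entails S c b -> entails S c (a /\ b).
Proof.
intros Ha Hb; refine (theorem_mp _ _ _ _ Hb).
refine (theorem_mp _ _ _ _ Ha); apply theorem_ax, A5.
Qed.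

Lemma entails_uncurry S a b c :
  entails S a (b -->H c) -> entails S (a /\ b) c.
Proof. apply theorem_mp, theorem_ax, A9. Qed.

Lemma entails_curry S a b c :
  entails S (a /\ b) c -> entails S a (b -->H c).
Proof. apply theorem_mp, theorem_ax, A8. Qed.

Lemma imp_equivl S a b c :
  equivalent S a b -> is_theorem S (a --> c) -> is_theorem S (b --> c).
Proof.
intros [Hab Hba]; apply theorem_mp.
refine (theorem_mp _ _ _ _ Hba); refine (theorem_mp _ _ _ _ Hab).
apply theorem_ax, A10.
Qed.

Lemma imp_equivr S a b c :
  equivalent S a b -> is_theorem S (c --> a) -> is_theorem S (c --> b).
Proof.
intros [Hab Hba]; apply theorem_mp.
refine (theorem_mp _ _ _ _ Hab); refine (theorem_mp _ _ _ _ Hba).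
apply theorem_ax, A11.
Qed.

(** [a -->H Top] unfolds to [a --> a /\ Top], and [a /\ Top] is equivalent to
    [a /\ a], so the consequent may be replaced. *)
Lemma entails_refl S a : entails S a a.
Proof.
assert (HT : is_theorem S Top) by apply theorem_ax, A6.
apply imp_equivr with (And a Top); [split | now apply entails_theorem].
- apply entails_and; apply entails_andl.
- apply entails_and; [apply entails_andl | now apply entails_theorem].
Qed.

Lemma entails_weakl S a b c : entails S b c -> entails S (a /\ b) c.
Proof. intros H; now apply entails_uncurry, entails_theorem. Qed.

Lemma entails_andr S a b : entails S (a /\ b) b.
Proof. apply entails_weakl, entails_refl. Qed.

Lemma equivalent_andC S a b : equivalent S (a /\ b) (b /\ a).
Proof.
split; apply entails_and; (apply entails_andl || apply entails_andr).
Qed.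

Lemma entails_equivl S a b c :
  equivalent S a b -> entails S a c -> entails S b c.
Proof.
intros Hab Hac; apply (imp_equivl _ a); [exact Hab |].
(* The equivalent formula is replaced as a right conjunct, the only position
   where a hypothesis can be weakened before transitivity is available. *)
assert (H : equivalent S (c /\ a) (c /\ b)).
{ destruct Hab; split; apply entails_and;
    (apply entails_andl || now apply entails_weakl). }
apply (imp_equivr _ _ _ _ (equivalent_andC _ c b)).
apply (imp_equivr _ _ _ _ H).
now apply (imp_equivr _ _ _ _ (equivalent_andC _ a c)).
Qed.

Lemma entails_trans S a b c : entails S a b -> entails S b c -> entails S a c.
Proof.
intros Hab Hbc; apply (entails_equivl _ (And a b)).
- split; [apply entails_andl |].
  apply entails_and; [apply entails_refl | exact Hab].
- now apply entails_weakl.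
Qed.

Lemma entails_weakr S a b c : entails S a c -> entails S (a /\ b) c.
Proof. apply entails_trans, entails_andl. Qed.

Lemma entails_app S x a b :
  entails S x (a -->H b) -> entails S x a -> entails S x b.
Proof.
intros Hab Ha; apply entails_trans with (And x a).
- apply entails_and; [apply entails_refl | exact Ha].
- now apply entails_uncurry.
Qed.

Lemma entails_orl S a b : entails S a (a \/ b).
Proof. apply theorem_ax, A1. Qed.

Lemma entails_orr S a b : entails S b (a \/ b).
Proof. apply theorem_ax, A2. Qed.

Lemma entails_weak_orl S a b c : entails S a b -> entails S a (b \/ c).
Proof. intros H; exact (entails_trans _ _ _ _ H (entails_orl _ _ _)). Qed.

Lemma entails_weak_orr S a b c : entails S a c -> entails S a (b \/ c).
Proof. intros H; exact (entails_trans _ _ _ _ H (entails_orr _ _ _)). Qed.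

Lemma entails_or S a b c :
  entails S a c -> entails S b c -> entails S (a \/ b) c.
Proof.
intros Ha Hb; refine (theorem_mp _ _ _ _ Hb).
refine (theorem_mp _ _ _ _ Ha); apply theorem_ax, A3.
Qed.

Lemma entails_top S a : entails S a Top.
Proof. apply entails_theorem, theorem_ax, A6. Qed.

Lemma entails_bot S a : entails S Bot a.
Proof. apply theorem_ax, A7. Qed.

Lemma entails_neg S a b : entails S a b -> entails S (~ b) (~ a).
Proof. apply d_SCP. Qed.

(** Under a hypothesis [x], both arguments of [-->] may be replaced by formulas
    equivalent to them modulo [x]. *)
Lemma entails_imp S x a b c d :
  entails S (x /\ a) b -> entails S (x /\ b) a ->
  entails S (x /\ c) d -> entails S (x /\ d) c ->
  entails S (x /\ (a --> c)) (b --> d).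
Proof.
intros Hab Hba Hcd Hdc; apply entails_uncurry.
assert (H1 : entails S x ((a --> c) -->H (b --> c))).
{ apply entails_app with (b -->H a)%fml; [| now apply entails_curry].
  apply entails_app with (a -->H b)%fml; [| now apply entails_curry].
  apply entails_theorem, theorem_ax, A10. }
assert (H2 : entails S x ((b --> c) -->H (b --> d))).
{ apply entails_app with (c -->H d)%fml; [| now apply entails_curry].
  apply entails_app with (d -->H c)%fml; [| now apply entails_curry].
  apply entails_theorem, theorem_ax, A11. }
apply entails_curry; apply entails_app with (b --> c)%fml.
- now apply entails_weakr.
- now apply entails_uncurry.
Qed.

Lemma equivalent_refl S a : equivalent S a a.
Proof. split; apply entails_refl. Qed.

Lemma equivalent_sym S a b : equivalent S a b -> equivalent S b a.
Proof. intros [H1 H2]; now split. Qed.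

Lemma equivalent_trans S a b c :
  equivalent S a b -> equivalent S b c -> equivalent S a c.
Proof. intros [H1 H2] [H3 H4]; split; eauto using entails_trans. Qed.

Lemma equivalent_or S a b c d :
  equivalent S a b -> equivalent S c d -> equivalent S (a \/ c) (b \/ d).
Proof.
intros [H1 H2] [H3 H4]; split; apply entails_or;
  auto using entails_weak_orl, entails_weak_orr.
Qed.

Lemma equivalent_and S a b c d :
  equivalent S a b -> equivalent S c d -> equivalent S (a /\ c) (b /\ d).
Proof.
intros [H1 H2] [H3 H4]; split; apply entails_and;
  auto using entails_weakl, entails_weakr.
Qed.

Lemma equivalent_imp S a b c d :
  equivalent S a b -> equivalent S c d ->
  equivalent S (a --> c) (b --> d).
Proof.
assert (H : forall a b c d, equivalent S a b -> equivalent S c d ->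
          entails S (a --> c) (b --> d)).
{ intros a' b' c' d' [H1 H2] [H3 H4].
  apply entails_trans with (And Top (a' --> c')).
  - apply entails_and; [apply entails_top | apply entails_refl].
  - apply entails_imp; now apply entails_weakl. }
intros Hab Hcd; split; apply H; auto using equivalent_sym.
Qed.

Lemma equivalent_neg S a b : equivalent S a b -> equivalent S (~ a) (~ b).
Proof. intros [H1 H2]; split; now apply entails_neg. Qed.

Lemma theorem_equivalent_top S a : is_theorem S a <-> equivalent S a Top.
Proof.
split.
- intros H; split; [apply entails_top | now apply entails_theorem].
- intros [_ H]; apply (theorem_mp _ _ _ H), theorem_ax, A6.
Qed.

Lemma entails_top_imp S a : entails S (Top --> a) a.
Proof.
apply entails_trans with (Top -->H a)%fml.
- refine (proj1 (equivalent_imp _ _ _ _ _ (equivalent_refl _ _) _)).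
  split; [| apply entails_andr].
  apply entails_and; [apply entails_top | apply entails_refl].
- apply entails_app with Top; [apply entails_refl | apply entails_top].
Qed.

Lemma entails_imp_top S a : entails S a (Top --> a).
Proof.
apply entails_trans with (Top -->H a)%fml.
- apply entails_curry, entails_andl.
- refine (proj1 (equivalent_imp _ _ _ _ _ (equivalent_refl _ _) _)).
  split; [apply entails_andr |].
  apply entails_and; [apply entails_top | apply entails_refl].
Qed.

Lemma equivalent_meet_imp S a b : equivalent S (a /\ (a --> b)) (a /\ b).
Proof.
(* Modulo a, the formula a is equivalent to Top. *)
split; (apply entails_and; [apply entails_andl |]).
- apply entails_trans with (Top --> b)%fml; [| apply entails_top_imp].
  apply entails_imp; auto using entails_top, entails_andl, entails_andr.
- apply entails_trans with (And a (Top --> b)).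
  + apply entails_and; [apply entails_andl |].
    apply entails_weakl, entails_imp_top.
  + apply entails_imp; auto using entails_top, entails_andl, entails_andr.
Qed.

Lemma equivalent_meet_imp_meet S a b c :
  equivalent S (a /\ (b --> c)) (a /\ ((a /\ b) --> (a /\ c))).
Proof.
split; (apply entails_and; [apply entails_andl |]); apply entails_imp;
  auto using entails_refl, entails_weakl, entails_andr.
Qed.

Lemma theorem_imp_refl S a : is_theorem S (a --> a).
Proof.
apply imp_equivr with (And a a); [| apply entails_refl].
split; [apply entails_andl | apply entails_and; apply entails_refl].
Qed.

(** * The Lindenbaum algebra *)

(** A chosen representative of the class of [a] modulo provable equivalence. *)
Definition repr (S : formula -> Prop) (a : formula) : formula :=
  epsilon (inhabits Top) (equivalent S a).

Lemma repr_equivalent S a : equivalent S a (repr S a).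
Proof.
apply (epsilon_spec (inhabits Top) (equivalent S a)); exists a.
apply equivalent_refl.
Qed.

Lemma repr_eq S a b : equivalent S a b -> repr S a = repr S b.
Proof.
intros H; unfold repr; f_equal.
apply functional_extensionality; intros c; apply propositional_extensionality.
split; eauto using equivalent_trans, equivalent_sym.
Qed.

Lemma repr_idem S a : repr S (repr S a) = repr S a.
Proof. symmetry; apply repr_eq, repr_equivalent. Qed.

(** The quotient of the formulas by provable equivalence, realized as the set of
    chosen representatives. *)
Definition classes (S : formula -> Prop) : Type := {a | repr S a = a}.

Definition cls (S : formula -> Prop) (a : formula) : classes S :=
  exist _ (repr S a) (repr_idem S a).

Lemma cls_eq S a b : cls S a = cls S b <-> equivalent S a b.
Proof.
split; intros H.
- apply (f_equal (@proj1_sig _ _)) in H; simpl in H.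
  apply equivalent_trans with (repr S a); [apply repr_equivalent |].
  rewrite H; apply equivalent_sym, repr_equivalent.
- apply subset_eq_compat; now apply repr_eq.
Qed.

Lemma cls_proj S (x : classes S) : cls S (proj1_sig x) = x.
Proof. destruct x as [a Ha]; now apply subset_eq_compat. Qed.

Definition lindenbaum (S : formula -> Prop) : algebra := {|
  carrier := classes S;
  join x y := cls S (proj1_sig x \/ proj1_sig y);
  meet x y := cls S (proj1_sig x /\ proj1_sig y);
  arrow x y := cls S (proj1_sig x --> proj1_sig y);
  prime x := cls S (~ proj1_sig x);
  zero := cls S Bot;
  one := cls S Top
|}.

Lemma proj_cls S a : equivalent S (proj1_sig (cls S a)) a.
Proof. apply equivalent_sym, repr_equivalent. Qed.

Lemma join_cls S a b :
  @join (lindenbaum S) (cls S a) (cls S b) = cls S (a \/ b).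
Proof. apply cls_eq, equivalent_or; apply proj_cls. Qed.

Lemma meet_cls S a b :
  @meet (lindenbaum S) (cls S a) (cls S b) = cls S (a /\ b).
Proof. apply cls_eq, equivalent_and; apply proj_cls. Qed.

Lemma arrow_cls S a b :
  @arrow (lindenbaum S) (cls S a) (cls S b) = cls S (a --> b).
Proof. apply cls_eq, equivalent_imp; apply proj_cls. Qed.

Lemma prime_cls S a : @prime (lindenbaum S) (cls S a) = cls S (~ a).
Proof. apply cls_eq, equivalent_neg; apply proj_cls. Qed.

(** Reduces an identity of the Lindenbaum algebra to the provable equivalence of
    the corresponding formulas. *)
Ltac to_classes :=
  intros;
  repeat match goal with
    x : carrier (lindenbaum _) |- _ => rewrite <- (cls_proj _ x);
      generalize (proj1_sig x); clear x; intro
  end;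
  change (@zero (lindenbaum ?S)) with (cls S Bot);
  change (@one (lindenbaum ?S)) with (cls S Top);
  repeat rewrite ?join_cls, ?meet_cls, ?arrow_cls, ?prime_cls;
  apply cls_eq.

Lemma lindenbaum_lattice S : is_bounded_lattice (lindenbaum S).
Proof.
split; to_classes; split;
  repeat (apply entails_or || apply entails_and);
  auto 7 using entails_refl, entails_top, entails_bot, entails_weakl,
    entails_weakr, entails_weak_orl, entails_weak_orr.
Qed.

Lemma lindenbaum_DHMSH S : is_DHMSH (lindenbaum S).
Proof.
split; [split; [apply lindenbaum_lattice | ..] | ..]; to_classes.
- apply equivalent_meet_imp.
- apply equivalent_meet_imp_meet.
- apply theorem_equivalent_top, theorem_imp_refl.
- split; [apply entails_top | apply theorem_ax, A12].
- split; [apply theorem_ax, A13 | apply entails_bot].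
- split; [apply theorem_ax, A14 |].
  apply entails_or; apply entails_neg; [apply entails_andl | apply entails_andr].
Qed.

(** * Substitution, evaluation and the Lindenbaum algebra *)

Lemma subst_Var f : subst Var f = f.
Proof. induction f; simpl; congruence. Qed.

Lemma subst_subst s t f :
  subst t (subst s f) = subst (fun n => subst t (s n)) f.
Proof. induction f; simpl; congruence. Qed.

Lemma DHMSH_axiom_subst s f : DHMSH_axiom f -> DHMSH_axiom (subst s f).
Proof. intros []; simpl; constructor. Qed.

Lemma theorem_subst S s f : is_theorem S f -> is_theorem S (subst s f).
Proof.
induction 1 as [f [] | f H | f t H | f g _ IH1 _ IH2 | f g _ IH].
- now apply theorem_ax, DHMSH_axiom_subst.
- rewrite subst_subst; now apply d_new.
- exact (d_SMP _ _ _ _ IH1 IH2).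
- now apply d_SCP.
Qed.

Lemma eval_ext (A : algebra) (v w : nat -> A) f :
  (forall n, v n = w n) -> eval A v f = eval A w f.
Proof. intros H; induction f; simpl; congruence. Qed.

Lemma eval_subst (A : algebra) v s f :
  eval A v (subst s f) = eval A (fun n => eval A v (s n)) f.
Proof. induction f; simpl; congruence. Qed.

Lemma eval_lindenbaum S s f :
  eval (lindenbaum S) (fun n => cls S (s n)) f = cls S (subst s f).
Proof.
induction f; simpl eval; rewrite ?IHf, ?IHf1, ?IHf2; simpl subst;
  first [reflexivity | apply join_cls | apply meet_cls | apply arrow_cls
        | apply prime_cls].
Qed.

Lemma lindenbaum_validates S f : validates (lindenbaum S) f <-> is_theorem S f.
Proof.
split.
- intros H; specialize (H (fun n => cls S (Var n))).
  rewrite eval_lindenbaum, subst_Var in H.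
  now apply theorem_equivalent_top, cls_eq.
- intros H v.
  rewrite (eval_ext (lindenbaum S) v (fun n => cls S (proj1_sig (v n))))
    by (intros n; now rewrite cls_proj).
  rewrite eval_lindenbaum.
  now apply cls_eq, theorem_equivalent_top, theorem_subst.
Qed.

Lemma derives_theorem S G f : is_theorem S f -> derives S G f.
Proof.
induction 1 as [f [] | f H | f t H | f g _ IH1 _ IH2 | f g _ IH];
  eauto using derives.
Qed.

Lemma derives_sub S S' G f :
  (forall g, is_theorem S g -> is_theorem S' g) ->
  derives S G f -> derives S' G f.
Proof.
intros HS; induction 1; eauto using derives.
now apply derives_theorem, HS, d_new.
Qed.

Lemma corresponds_unique V S S' :
  corresponds V S -> corresponds V S' -> same_logic S' S.
Proof.
assert (H : forall S S', corresponds V S -> corresponds V S' ->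
          forall f, is_theorem S' f -> is_theorem S f).
{ intros T T' HT HT' f Hf; apply lindenbaum_validates.
  apply (proj1 (HT' _)); [| exact Hf].
  apply HT; split; [apply lindenbaum_DHMSH |].
  intros d; apply lindenbaum_validates. }
intros HS HS' G f; split; apply derives_sub; now apply H.
Qed.

Lemma corresponds_logic V S : corresponds V S -> is_logic_of V S.
Proof. split; [easy | intros S' HS'; now apply (corresponds_unique V)]. Qed.

(** * Models of a set of formulas form a variety *)

Lemma eval_hom (A B : algebra) h v f :
  is_hom A B h -> h (eval A v f) = eval B (fun n => h (v n)) f.
Proof.
intros [Hj Hm Ha Hp H0 H1]; induction f; simpl; congruence.
Qed.

Lemma eval_product I (F : I -> algebra) v f i :
  eval (product I F) v f i = eval (F i) (fun n => v n i) f.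
Proof. induction f; simpl; congruence. Qed.

Lemma DHMSH_variety : is_variety is_DHMSH.
Proof.
split.
- intros A B h [Hj Hm Ha Hp H0 H1] surj
    [[[jC mC jA mA jm mj j0 m1] ma mam ad] p0 p1 pm].
  repeat split; intros;
    repeat match goal with
      y : carrier B |- _ => destruct (surj y) as [? <-]; clear y
    end;
    rewrite <- ?H0, <- ?H1;
    repeat rewrite <- ?Hj, <- ?Hm, <- ?Ha, <- ?Hp; f_equal; auto.
- intros A B h [Hj Hm Ha Hp H0 H1] inj
    [[[jC mC jA mA jm mj j0 m1] ma mam ad] p0 p1 pm].
  repeat split; intros; apply inj;
    repeat rewrite ?Hj, ?Hm, ?Ha, ?Hp, ?H0, ?H1; auto.
- intros I F HF; repeat split; intros;
    apply functional_extensionality_dep; intros i; simpl;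
    destruct (HF i) as [[[jC mC jA mA jm mj j0 m1] ma mam ad] p0 p1 pm]; auto.
Qed.

Lemma models_variety (T : formula -> Prop) :
  is_variety (fun A => is_DHMSH A /\ forall d, T d -> validates A d).
Proof.
destruct DHMSH_variety as [DH DS DP]; split.
- intros A B h Hh surj [HA HT]; split; [now apply (DH A B h) |].
  intros d Hd v.
  set (u := fun n =>
    proj1_sig (constructive_indefinite_description _ (surj (v n)))).
  rewrite (eval_ext B v (fun n => h (u n))).
  + rewrite <- (eval_hom A B h u d Hh), (HT d Hd u); apply Hh.
  + intros n; unfold u.
    now destruct (constructive_indefinite_description _ (surj (v n))).
- intros A B h Hh inj [HB HT]; split; [now apply (DS A B h) |].
  intros d Hd v; apply inj.
  rewrite (eval_hom A B h v d Hh), (HT d Hd); symmetry; apply Hh.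
- intros I F HF; split; [apply DP; intros i; apply HF |].
  intros d Hd v; apply functional_extensionality_dep; intros i.
  rewrite eval_product; now apply HF.
Qed.

(** * Birkhoff's theorem *)

(** Two valuations can be merged into one, at the price of renaming variables
    apart: [v] is read at the even indices and [w] at the odd ones. *)
Definition interleave {X : Type} (v w : nat -> X) (n : nat) : X :=
  if Nat.even n then v (Nat.div2 n) else w (Nat.div2 n).

Lemma interleave_even X (v w : nat -> X) n : interleave v w (2 * n) = v n.
Proof.
unfold interleave; now rewrite Nat.even_even, Nat.div2_double.
Qed.

Lemma interleave_odd X (v w : nat -> X) n : interleave v w (S (2 * n)) = w n.
Proof.
unfold interleave.
now rewrite <- Nat.add_1_r, Nat.even_odd, Nat.add_1_r, Nat.div2_succ_double.
Qed.

(** The product of the [F j] over all pairs of an index [j] and a map from [A] to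
    [F j]; the algebra freely generated by [A] in the variety generated by the
    [F j] is its subalgebra generated by the points [point a]. *)
Definition big_product {J : Type} (F : J -> algebra) (A : algebra) : algebra :=
  product {j : J & A -> F j} (fun i => F (projT1 i)).

Definition point {J : Type} (F : J -> algebra) (A : algebra) (a : A) :
  big_product F A := fun i => projT2 i a.

(** [common_value F A x a]: the elements [x] and [a] are the values of one term,
    over generators [point (v n)] and [v n] respectively. *)
Definition common_value {J : Type} (F : J -> algebra) (A : algebra)
    (x : big_product F A) (a : A) : Prop :=
  exists v f, eval (big_product F A) (fun n => point F A (v n)) f = x /\
              eval A v f = a.

(** Any two pairs of common values are obtained from the same valuation. *)
Lemma common_value_pair J (F : J -> algebra) (A : algebra) x a y b :
  common_value F A x a -> common_value F A y b ->
  exists v f g,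
    (eval (big_product F A) (fun n => point F A (v n)) f = x /\
     eval A v f = a) /\
    (eval (big_product F A) (fun n => point F A (v n)) g = y /\
     eval A v g = b).
Proof.
intros [v [f [<- <-]]] [w [g [<- <-]]].
exists (interleave v w), (subst (fun n => Var (2 * n)) f),
  (subst (fun n => Var (S (2 * n))) g).
repeat split; rewrite eval_subst; apply eval_ext; intros n; cbn [eval];
  now rewrite ?interleave_even, ?interleave_odd.
Qed.

(** The assignment of [a] to [x] is well defined as soon as [A] satisfies the
    equations of the [F j]. *)
Lemma common_value_functional J (F : J -> algebra) (A : algebra) x a b :
  (forall f g, (forall j v, eval (F j) v f = eval (F j) v g) ->
     forall v, eval A v f = eval A v g) ->
  common_value F A x a -> common_value F A x b -> a = b.
Proof.
intros HA Ha Hb.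
destruct (common_value_pair _ _ _ _ _ _ _ Ha Hb)
  as [v [f [g [[Hf <-] [Hg <-]]]]].
(* Variables with the same value under v are identified, so that every valuation
   of the remaining ones factors through v. *)
set (e := fun c => epsilon (inhabits 0) (fun m => v m = c)).
assert (He : forall n, v (e (v n)) = v n).
{ intros n; apply (epsilon_spec (inhabits 0) (fun m => v m = v n)).
  now exists n. }
assert (Hren : forall h, eval A v h =
          eval A v (subst (fun n => Var (e (v n))) h)).
{ intros h; rewrite eval_subst; apply eval_ext; intros n; simpl.
  now rewrite He. }
rewrite (Hren f), (Hren g); apply HA; intros j t; rewrite !eval_subst.
set (i := existT _ j (fun c => t (e c)) : {j : J & A -> F j}).
assert (H := eq_trans Hf (eq_sym Hg)).
apply (f_equal (fun z : big_product F A => z i)) in H.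
unfold big_product in H; rewrite !eval_product in H; exact H.
Qed.

Lemma common_value_op0 J (F : J -> algebra) (A : algebra) :
  common_value F A zero zero /\ common_value F A one one.
Proof.
split; [exists (fun _ => zero), Bot | exists (fun _ => zero), Top]; now split.
Qed.

Lemma common_value_prime J (F : J -> algebra) (A : algebra) x a :
  common_value F A x a -> common_value F A (prime x) (prime a).
Proof. intros [v [f [<- <-]]]; now exists v, (Neg f). Qed.

Lemma common_value_op2 J (F : J -> algebra) (A : algebra) x a y b :
  common_value F A x a -> common_value F A y b ->
  common_value F A (join x y) (join a b) /\
  common_value F A (meet x y) (meet a b) /\
  common_value F A (arrow x y) (arrow a b).
Proof.
intros Hx Hy.
destruct (common_value_pair _ _ _ _ _ _ _ Hx Hy)
  as [v [f [g [[<- <-] [<- <-]]]]].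
split; [| split]; [exists v, (Or f g) | exists v, (And f g)
                  | exists v, (Imp f g)]; now split.
Qed.

Definition common_pairs {J : Type} (F : J -> algebra) (A : algebra) : Type :=
  {p : big_product F A * A | common_value F A (fst p) (snd p)}.

(** The subalgebra of the product of [big_product F A] and [A] generated by the
    pairs [(point a, a)].  When [common_value] is functional, it is the graph of a
    homomorphism from a subalgebra of [big_product F A] onto [A]. *)
Definition common_algebra {J : Type} (F : J -> algebra) (A : algebra) :
    algebra := {|
  carrier := common_pairs F A;
  join p q := exist _ (_, _) (proj1
    (common_value_op2 J F A _ _ _ _ (proj2_sig p) (proj2_sig q)));
  meet p q := exist _ (_, _) (proj1 (proj2
    (common_value_op2 J F A _ _ _ _ (proj2_sig p) (proj2_sig q))));
  arrow p q := exist _ (_, _) (proj2 (proj2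
    (common_value_op2 J F A _ _ _ _ (proj2_sig p) (proj2_sig q))));
  prime p := exist _ (_, _) (common_value_prime J F A _ _ (proj2_sig p));
  zero := exist _ (_, _) (proj1 (common_value_op0 J F A));
  one := exist _ (_, _) (proj2 (common_value_op0 J F A))
|}.

(** Birkhoff's theorem: [A] is a homomorphic image of [common_algebra F A], which
    embeds into a product of the [F j]. *)
Theorem variety_of_equations J (F : J -> algebra) C A :
  is_variety C -> (forall j, C (F j)) ->
  (forall f g, (forall j v, eval (F j) v f = eval (F j) v g) ->
     forall v, eval A v f = eval A v g) ->
  C A.
Proof.
intros [CH CS CP] HF HA.
apply (CH (common_algebra F A) A (fun p => snd (proj1_sig p))).
- now split.
- intros a.
  assert (H : common_value F A (point F A a) a)
    by (now exists (fun _ => a), (Var 0)).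
  now exists (exist _ (point F A a, a) H).
- apply (CS (common_algebra F A) (big_product F A)
           (fun p => fst (proj1_sig p))).
  + now split.
  + intros [[x a] Ha] [[y b] Hb]; simpl in *; intros <-.
    apply subset_eq_compat; f_equal.
    exact (common_value_functional _ _ _ _ _ _ HA Ha Hb).
  + apply CP; intros i; apply HF.
Qed.

Lemma meet_idem (A : algebra) (x : A) : is_bounded_lattice A -> meet x x = x.
Proof.
intros L; rewrite <- (join_zero A L x) at 2; apply (meet_join A L).
Qed.

(** The interpretation of [a -->H b] has value 1 exactly when [a] lies below
    [b] in the lattice order. *)
Lemma arrow_meet_eq1 (A : algebra) (x y : A) :
  is_DHMSH A -> (arrow x (meet x y) = one <-> meet x y = x).
Proof.
intros [[L ma _ ad] _ _ _]; split; intros H.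
- assert (E : meet x (meet x y) = x)
    by (rewrite <- ma, H; apply (meet_one A L)).
  rewrite (meetA A L) in E.
  now rewrite (meet_idem A x L) in E.
- rewrite H; apply ad.
Qed.

Lemma validates_eq (A : algebra) f g :
  is_DHMSH A ->
  (forall v, eval A v f = eval A v g) <->
  (validates A (f -->H g) /\ validates A (g -->H f)).
Proof.
intros HA; assert (L := sH_lattice A (DH_semi_Heyting A HA)); split.
- intros H; split; intros v; simpl; rewrite H;
    now apply arrow_meet_eq1, meet_idem.
- intros [H1 H2] v; specialize (H1 v); specialize (H2 v); simpl in H1, H2.
  apply arrow_meet_eq1 in H1; [| exact HA].
  apply arrow_meet_eq1 in H2; [| exact HA].
  rewrite <- H1, (meetC A L); exact H2.
Qed.

Corollary variety_of_formulas J (F : J -> algebra) C A :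
  is_variety C -> (forall j, C (F j)) -> (forall j, is_DHMSH (F j)) ->
  is_DHMSH A ->
  (forall d, (forall j, validates (F j) d) -> validates A d) ->
  C A.
Proof.
intros HC HF HD HA H; apply (variety_of_equations J F C A HC HF).
intros f g Hfg; apply validates_eq; [exact HA |].
split; apply H; intros j; now apply (validates_eq (F j) f g (HD j)).
Qed.

(** * The two-element algebras *)

Lemma two_DHMSH A : A = two_e \/ A = two_bar_e -> is_DHMSH A.
Proof.
intros [-> | ->]; repeat split; simpl; intros; repeat
  match goal with x : bool |- _ => destruct x end; reflexivity.
Qed.

Lemma two_axiom A d :
  A = two_e \/ A = two_bar_e -> DHMSH_axiom d -> validates A d.
Proof.
intros HA Hd v; destruct HA as [-> | ->]; destruct Hd; simpl;
  repeat match goal with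
    |- context [eval ?A v ?f] => destruct (eval A v f)
  end; reflexivity.
Qed.

Lemma two_sound A S d :
  A = two_e \/ A = two_bar_e ->
  (forall f s, S f -> validates A (subst s f)) ->
  is_theorem S d -> validates A d.
Proof.
intros HA HS; induction 1 as [f [] | f H | f t H | f g _ IH1 _ IH2 | f g _ IH].
- now apply two_axiom.
- now apply HS.
- intros v; specialize (IH1 v); specialize (IH2 v); simpl in IH2.
  rewrite IH1 in IH2.
  destruct HA as [-> | ->]; simpl in *;
    [destruct (eval two_e v g) | destruct (eval two_bar_e v g)]; easy.
- intros v; specialize (IH v).
  destruct HA as [-> | ->]; simpl in *;
    [destruct (eval two_e v g), (eval two_e v f)
    | destruct (eval two_bar_e v g), (eval two_bar_e v f)]; easy.
Qed.

Lemma validates_subst (A : algebra) s f : validates A f -> validates A (subst s f).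
Proof. intros H v; rewrite eval_subst; apply H. Qed.

(** A variety generated by two-element algebras consists of models of any
    extension that these generators validate. *)
Lemma generated_models (K : algebra -> Prop) S A :
  (forall B, K B -> B = two_e \/ B = two_bar_e) ->
  (forall B f s, K B -> S f -> validates B (subst s f)) ->
  generated_variety K A ->
  is_DHMSH A /\ forall d, is_theorem S d -> validates A d.
Proof.
intros HK HS HA; apply (HA _ (models_variety (is_theorem S))).
intros B HB; split; [now apply two_DHMSH, HK |].
intros d; apply two_sound; [now apply HK |].
intros f s; now apply HS.
Qed.

(** The presentation of the logic of the larger variety by all the formulas that
    both generators validate. *)
Definition valid_in_both (f : formula) : Prop :=
  validates two_e f /\ validates two_bar_e f.

Lemma corresponds_valid_in_both : corresponds V_two_e_two_bar_e valid_in_both.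
Proof.
intros A; split.
- apply generated_models; [easy |].
  intros B f s [-> | ->] [H1 H2]; now apply validates_subst.
- intros [HA Hval] C HC HK.
  set (F := fun b : bool => if b then two_e else two_bar_e).
  apply (variety_of_formulas bool F); auto.
  + intros []; apply HK; auto.
  + intros []; apply two_DHMSH; auto.
  + intros d Hd; apply Hval; rewrite <- subst_Var; apply d_new.
    exact (conj (Hd true) (Hd false)).
Qed.

Lemma corresponds_adjoin L :
  corresponds V_two_e_two_bar_e L ->
  corresponds V_two_bar_e (adjoin L ((Bot --> Top) -->H Bot)%fml).
Proof.
intros HL A; split.
- apply generated_models; [auto |].
  intros B f s -> [Hf | ->]; [| easy].
  assert (HB : V_two_e_two_bar_e two_bar_e) by (intros C _ HK; apply HK; auto).
  apply (proj1 (HL _) HB); now apply d_new.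
- intros [HA Hval] C HC HK.
  assert (HV : V_two_e_two_bar_e A).
  { apply HL; split; [exact HA |]; intros d Hd; apply Hval.
    apply (derives_sub L); [| exact Hd]; intros g; unfold is_theorem.
    induction 1; eauto using derives.
    apply d_new; now left. }
  assert (Hax : forall v, eval A v (Bot --> Top) = zero).
  { intros v.
    assert (H : validates A ((Bot --> Top) -->H Bot)).
    { apply Hval; rewrite <- (subst_Var _); apply d_new; now right. }
    specialize (H v); simpl in H.
    apply arrow_meet_eq1 in H; [| exact HA].
    assert (Lat := sH_lattice A (DH_semi_Heyting A HA)).
    simpl; rewrite <- H, (meetC A Lat).
    rewrite <- (join_zero A Lat (arrow zero one)), (joinC A Lat).
    apply (meet_join A Lat). }
  apply (variety_of_formulas unit (fun _ => two_bar_e)); auto.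
  + intros _; apply two_DHMSH; auto.
  + intros d Hd v.
    (* The disjunction of 0 -> 1 with d is valid in both generators. *)
    assert (H : validates A ((Bot --> Top) \/ d)).
    { apply (proj1 (corresponds_valid_in_both A) HV).
      rewrite <- subst_Var; apply d_new; split; intros w; simpl; [easy |].
      exact (Hd tt w). }
    specialize (H v); cbn [eval] in H.
    assert (Lat := sH_lattice A (DH_semi_Heyting A HA)).
    rewrite <- H; change (arrow zero one) with (eval A v (Bot --> Top)).
    now rewrite Hax, (joinC A Lat), (join_zero A Lat).
Qed.

Theorem corollary7p3 :
  (exists L : formula -> Prop, is_logic_of V_two_e_two_bar_e L) /\
  (forall L : formula -> Prop,
     is_logic_of V_two_e_two_bar_e L ->
     is_logic_of V_two_bar_e (adjoin L ((Bot --> Top) -->H Bot)%fml)).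
Proof.
split.
- exists valid_in_both.
  apply corresponds_logic, corresponds_valid_in_both.
- intros L [HL _]; now apply corresponds_logic, corresponds_adjoin.
Qed.
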